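(* Let $\mathfrak R=(R_k,\zeta_k)_{k\in\mathcal K}$ be a reference family with a forest structure on $\{1,\dots,m\}$, let $\mathcal K^{\mathfrak{pr}}\subseteq\mathcal K$ be its pruned index set (as defined in the context), and let $\mathfrak R^{\mathfrak{pr}}=(R_k,\zeta_k)_{k\in\mathcal K^{\mathfrak{pr}}}$. Then for any $S\subseteq\{1,\dots,m\}$, $$V^*_{\mathfrak R}(S)=V^*_{\mathfrak R^{\mathfrak{pr}}}(S).$$
   Context: **Reference family with forest structure.** Let $m\ge1$ and let $(P_n)_{1\le n\le N}$ be a partition of $\{1,\dots,m\}$ into non-empty sets (called atoms or leaves). Let $\mathcal K\subseteq\{(a,b):1\le a\le b\le N\}$ be non-empty and for $k=(a,b)\in\mathcal K$ let $R_k=R_{(a,b)}=\bigcup_{a\le n\le b}P_n$. (So the $R_k$ are non-empty and pairwise distinct.) The forest structure assumption is: for all $k,k'\in\mathcal K$, $R_k\cap R_{k'}\in\{R_k,R_{k'},\varnothing\}$. For each $k\in\mathcal K$ let $\zeta_k\in\{0,\dots,|R_k|\}$ be an integer. The reference family is $\mathfrak R=(R_k,\zeta_k)_{k\in\mathcal K}$. **Bound.** For such a family and $S\subseteq\{1,\dots,m\}$, $V^*_{\mathfrak R}(S)=\max\{|S\cap A|: A\subseteq\{1,\dots,m\},\ |R_k\cap A|\le\zeta_k\ \text{for all }k\in\mathcal K\}$. $V^*_{\mathfrak R^{\mathfrak{pr}}}$ is defined in the same way with $\mathcal K^{\mathfrak{pr}}$ in place of $\mathcal K$. **Pruning.** $\mathcal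 K^{\mathfrak{pr}}$ is the set of elements of $\mathcal K$ from which one removes all $(i,i')\in\mathcal K$ such that there exist $p\ge2$ and integers $i_1,\dots,i_{p-1}$ such that, setting $i_0=i$ and $i_p=i'+1$, the sequence $(i_0,\dots,i_p)$ is strictly increasing, $(i_{j-1},i_j-1)\in\mathcal K$ for all $1\le j\le p$, and $\zeta_{(i,i')}=\zeta_{(i_0,i_p-1)}\ge\sum_{j=1}^p\zeta_{(i_{j-1},i_j-1)}$. *)

(* Defs.v *)
From mathcomp Require Import all_boot finmap.
From mathcomp Require Import boolp.

Set Implicit Arguments.
Unset Strict Implicit.
Unset Printing Implicit Defensive.

Local Open Scope nat_scope.

(* {1, ..., m} is rendered as 'I_m.  The labels n of the atoms P_n and the
   index pairs (a, b) keep their 1-based numbering as natural numbers, so that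
   values such as i' + 1 (possibly N + 1) need no cast. *)

Definition atoms_partition (m N : nat) (P : nat -> {set 'I_m}) : Prop :=
  [/\ forall n, 1 <= n <= N -> P n != set0,
      forall n n', 1 <= n <= N -> 1 <= n' <= N -> n != n' ->
        [disjoint P n & P n']
    & \bigcup_(1 <= n < N.+1) P n = [set: 'I_m]].

Definition region (m : nat) (P : nat -> {set 'I_m}) (k : nat * nat)
  : {set 'I_m} :=
  \bigcup_(k.1 <= n < k.2.+1) P n.

Record reference_family (m N : nat) (P : nat -> {set 'I_m})
    (K : {fset nat * nat}) (zeta : nat * nat -> nat) : Prop := ReferenceFamily {
  rf_partition : atoms_partition N P;
  rf_nonempty : K != fset0;
  rf_index : forall k, k \in K -> 1 <= k.1 <= k.2 /\ k.2 <= N;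
  rf_zeta : forall k, k \in K -> zeta k <= #|region P k|
}.

Definition forest_structure (m : nat) (P : nat -> {set 'I_m})
    (K : {fset nat * nat}) : Prop :=
  forall k k', k \in K -> k' \in K ->
    region P k :&: region P k' \in [set region P k; region P k'; set0].

Definition admissible (m : nat) (P : nat -> {set 'I_m}) (K : {fset nat * nat})
    (zeta : nat * nat -> nat) (A : {set 'I_m}) : bool :=
  [forall k : K, #|region P (val k) :&: A| <= zeta (val k)].

(* The default value 0 of \max is harmless: set0 is always admissible. *)
Definition Vstar (m : nat) (P : nat -> {set 'I_m}) (K : {fset nat * nat})
    (zeta : nat * nat -> nat) (S : {set 'I_m}) : nat :=
  \max_(A : {set 'I_m} | admissible P K zeta A) #|S :&: A|.

(* Only i_0, ..., i_p matter.  Natural numbers suffice for the integers i_j, and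
   the predecessors are genuine, because i_0 >= 1 and the i_j increase. *)
Definition prunable (K : {fset nat * nat}) (zeta : nat * nat -> nat)
    (k : nat * nat) : Prop :=
  exists (p : nat) (i : nat -> nat),
    [/\ 2 <= p,
        i 0 = k.1 /\ i p = k.2.+1,
        forall j, 1 <= j <= p -> i j.-1 < i j,
        forall j, 1 <= j <= p -> (i j.-1, (i j).-1) \in K
      & \sum_(1 <= j < p.+1) zeta (i j.-1, (i j).-1) <= zeta k].

Definition pruned (K : {fset nat * nat}) (zeta : nat * nat -> nat)
  : {fset nat * nat} :=
  [fset k in K | ~~ `[< prunable K zeta k >]]%fset.

(* Main.v *)
Require Import Defs.
From mathcomp Require Import all_boot finmap.
From mathcomp Require Import boolp zify.

Set Implicit Arguments.
Unset Strict Implicit.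
Unset Printing Implicit Defensive.

(** Pruning does not change which sets [A] are admissible, so both maxima range
    over the same sets.  A constraint [k] is pruned only when its region is cut
    into at least two consecutive regions of the family whose budgets add up to
    at most [zeta k]; by subadditivity of the cardinality
    ([leq_card_region_chain]) the constraints on the pieces imply the one on
    [k].  The pieces may themselves have been pruned, but they are strictly
    shorter intervals ([chain_piece_shorter]), so a strong induction on the
    length of the interval recovers every constraint from those that survive
    ([admissible_pruned]). *)

(** The quantitative form of monotonicity is what makes a piece strictly
    shorter than the whole chain: every other step has length at least one. *)
Lemma chain_growth (p : nat) (i : nat -> nat) q r :
  (forall j, 1 <= j <= p -> i j.-1 < i j) ->
  q <= r <= p -> i q + (r - q) <= i r.
Proof.
move=> i_incr; elim: r => [|r IHr]; first by case: q => // _; rewrite addn0.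
case/andP; rewrite leq_eqVlt => /orP[/eqP-> _|ltqr ler].
  by rewrite subnn addn0.
have := IHr; have /= := i_incr r.+1; lia.
Qed.

Lemma chain_piece_shorter (p : nat) (i : nat -> nat) j :
  (forall j, 1 <= j <= p -> i j.-1 < i j) ->
  2 <= p -> 1 <= j <= p -> i j - i j.-1 < i p - i 0.
Proof.
move=> i_incr p_ge2 j_bounds.
have := chain_growth (q := 0) (r := j.-1) i_incr.
have := chain_growth (q := j) (r := p) i_incr.
have := i_incr j; lia.
Qed.

Lemma leq_card_region_chain (m : nat) (P : nat -> {set 'I_m})
    (A : {set 'I_m}) (p : nat) (i : nat -> nat) q :
  (forall j, 1 <= j <= p -> i j.-1 < i j) ->
  q <= p ->
  #|(\bigcup_(i 0 <= n < i q) P n) :&: A|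
    <= \sum_(1 <= j < q.+1) #|region P (i j.-1, (i j).-1) :&: A|.
Proof.
move=> i_incr; elim: q => [_|q IHq lt_qp].
  by rewrite big_geq // set0I cards0.
have i0q : i 0 <= i q by have := chain_growth (q := 0) (r := q) i_incr; lia.
have iqS : i q < i q.+1 by apply: (i_incr q.+1).
rewrite big_nat_recr //= (big_cat_nat i0q (ltnW iqS)) /= setIUl.
apply: leq_trans (leq_card_setU _ _) _; apply: leq_add; first exact/IHq/ltnW.
by rewrite /region /= (ltn_predK iqS).
Qed.

Lemma admissibleP (m : nat) (P : nat -> {set 'I_m}) (K : {fset nat * nat})
    (zeta : nat * nat -> nat) (A : {set 'I_m}) :
  reflect (forall k, k \in K -> #|region P k :&: A| <= zeta k)
    (admissible P K zeta A).
Proof.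
apply: (iffP forallP) => [Aok k kK | Aok k]; first exact: (Aok [` kK]%fset).
exact/Aok/fsvalP.
Qed.

Lemma mem_pruned (K : {fset nat * nat}) (zeta : nat * nat -> nat) k :
  (k \in pruned K zeta) = (k \in K) && ~~ `[< prunable K zeta k >].
Proof. by rewrite !inE. Qed.

Lemma admissible_pruned (m : nat) (P : nat -> {set 'I_m})
    (K : {fset nat * nat}) (zeta : nat * nat -> nat) (A : {set 'I_m}) :
  admissible P (pruned K zeta) zeta A = admissible P K zeta A.
Proof.
apply/admissibleP/admissibleP => Aok k; last first.
  by rewrite mem_pruned => /andP[kK _]; apply: Aok.
have [l] := ubnP (k.2.+1 - k.1).
elim: l k => // l IHl k k_short kK.
have [|k_kept] := boolP `[< prunable K zeta k >]; last first.
  by apply: Aok; rewrite mem_pruned kK.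
case/asboolP=> p [i [p_ge2 [i0 ip] i_incr iK le_zeta]].
apply: leq_trans le_zeta.
rewrite {1}/region -i0 -ip.
apply: leq_trans (leq_card_region_chain P A i_incr (leqnn p)) _.
rewrite !big_nat; apply: leq_sum => j j_bounds.
apply: IHl (iK j j_bounds) => /=.
rewrite (ltn_predK (i_incr j j_bounds)).
apply: leq_trans (chain_piece_shorter i_incr p_ge2 j_bounds) _.
by rewrite i0 ip.
Qed.

Theorem proposition3p1 (m N : nat) (P : nat -> {set 'I_m})
    (K : {fset nat * nat}) (zeta : nat * nat -> nat) (S : {set 'I_m}) :
  1 <= m ->
  reference_family N P K zeta ->
  forest_structure P K ->
  Vstar P K zeta S = Vstar P (pruned K zeta) zeta S.
Proof.
move=> _ _ _; rewrite /Vstar.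
by apply: eq_bigl => A; rewrite admissible_pruned.
Qed.
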